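(* Let $d\ge2$, $k>0$, and for $x\in\mathbb R^d$ put $S(x)=\sum_{i=1}^dx_i$, $Q(x)=\sum_{i=1}^dx_i^2-S(x)^2/d$, $r_k=k/\sqrt{d(d-1)}$, and $$\Omega_k=\{x\in\mathbb R^d:\ |S(x)|<k,\ Q(x)<r_k^2\}.$$ Let $A=[-1,1]^d$, $\lambda=1$, dynamics $\dot x(t)=a(t)/d$ with measurable controls $a:[0,\infty)\to A$, and running cost $f(a)=\frac1d\sum_{i=1}^d(1-a_i)$. Then the state-constraint value function on $\overline\Omega_k$ is $$u_k(x)=\exp(S(x)-k),\qquad x\in\overline\Omega_k,$$ that is, for every $x\in\overline\Omega_k$ (including the points where $|S(x)|=k$ and $Q(x)=r_k^2$), the infimum of $\int_0^\infty e^{-t}f(a(t))\,dt$ over all measurable $a:[0,\infty)\to A$ whose trajectory $X(t)=x+\frac1d\int_0^ta(s)\,ds$ stays in $\overline\Omega_k$ for all $t\ge0$ equals $\exp(S(x)-k)$. Moreover, $u_k$ is a viscosity solution of $u+H(Du)=0$ in $\Omega_k$ and a viscosity supersolution of it on $\overline\Omega_k$, where $$H(p)=\frac1d\sum_{i=1}^d(|p_i-1|-1).$$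
   Context: A continuous $u$ is a viscosity supersolution of $u+H(Du)=0$ on $\overline\Omega_k$ if, whenever $\varphi$ is $C^1$ near $x\in\overline\Omega_k$ and $u-\varphi$ has a local minimum at $x$ relative to $\overline\Omega_k$, then $u(x)+H(D\varphi(x))\ge0$. ''Viscosity solution in $\Omega_k$'' is the usual notion on the open set. The Hamiltonian is $H(p)=\sup_{a\in A}\{-\frac ad\cdot p-f(a)\}$. *)

(* Defs.v *)
From HB Require Import structures.
From mathcomp Require Import all_boot all_order all_algebra.
From mathcomp Require Import all_classical all_reals all_analysis.

Set Implicit Arguments.
Unset Strict Implicit.
Unset Printing Implicit Defensive.

Import Order.TTheory GRing.Theory Num.Theory.
Import numFieldNormedType.Exports.

Local Open Scope classical_set_scope.
Local Open Scope ring_scope.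

(* Vectors of R^d are row matrices; their topology is the product topology. *)

Section domain.
Context {R : realType} {d : nat}.
Implicit Type x : 'rV[R]_d.

Definition coord_sum x : R := \sum_i x 0 i.

Definition quad_dev x : R := (\sum_i x 0 i ^+ 2) - coord_sum x ^+ 2 / d%:R.

Definition base_radius (k : R) : R := k / Num.sqrt (d%:R * (d%:R - 1)).

Definition Omega (k : R) : set 'rV[R]_d :=
  [set x | `|coord_sum x| < k /\ quad_dev x < base_radius k ^+ 2].

End domain.

(* The real line with the Lebesgue sigma-algebra (Caratheodory-measurable sets),
   on which [completed_lebesgue_measure] lives; the default sigma-algebra on R
   is the smaller Borel one. *)
Notation lebesgueR R := (caratheodory_type ((wlength (@idfun R))^*)%mu).

Section control.
Context {R : realType} {d : nat}.
Implicit Types (x : 'rV[R]_d) (a : R -> 'rV[R]_d).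

Local Notation leb := (@completed_lebesgue_measure R).

Definition controlSet : set 'rV[R]_d := [set c | forall i, -1 <= c 0 i <= 1].

Definition running_cost (c : 'rV[R]_d) : R := d%:R^-1 * \sum_i (1 - c 0 i).

Definition hamiltonian (p : 'rV[R]_d) : R :=
  sup [set - (\sum_i (c 0 i / d%:R) * p 0 i) - running_cost c
      | c in controlSet].

(* A control is only constrained on [0, +oo[; its values at negative times are
   irrelevant. Measurability into R^d is componentwise Lebesgue measurability. *)
Definition control a : Prop :=
  (forall t, 0 <= t -> controlSet (a t)) /\
  forall i, measurable_fun (`[0, +oo[ : set (lebesgueR R))
                           ((fun t => a t 0 i) : lebesgueR R -> R).

Definition trajectory x a (t : R) : 'rV[R]_d :=
  x + d%:R^-1 *: \row_i (\int[leb]_(s in `[0, t]) (a s 0 i))%R.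

(* discount rate 1 *)
Definition cost a : \bar R :=
  (\int[leb]_(t in `[0%R, +oo[) (expR (- t) * running_cost (a t))%:E)%E.

Definition admissible (K : set 'rV[R]_d) x : set (R -> 'rV[R]_d) :=
  [set a | control a /\ forall t, 0 <= t -> K (trajectory x a t)].

(* Valued in the extended reals, so that the infimum of an empty set of costs
   is +oo. *)
Definition value_function (K : set 'rV[R]_d) x : \bar R :=
  ereal_inf [set cost a | a in admissible K x].

End control.

Section viscosity.
Context {R : realType} {d : nat}.
Implicit Types (u phi : 'rV[R]_d -> R) (H : 'rV[R]_d -> R) (K : set 'rV[R]_d).

Definition gradient phi (x : 'rV[R]_d) : 'rV[R]_d :=
  \row_i 'D_(delta_mx 0 i) phi x.

Definition C1_near phi (x : 'rV[R]_d) : Prop :=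
  \forall y \near x, differentiable phi y /\ {for y, continuous (gradient phi)}.

(* Sub- and supersolutions of u + H(Du) = 0 on an arbitrary set K, the local
   extrema being relative to K. When K is open this is the usual notion; the
   values of u outside K play no role. *)
Definition viscosity_subsolution H K u : Prop :=
  {within K, continuous u} /\
  forall phi x, K x -> C1_near phi x ->
    (\forall y \near x, K y -> u y - phi y <= u x - phi x) ->
    u x + H (gradient phi x) <= 0.

Definition viscosity_supersolution H K u : Prop :=
  {within K, continuous u} /\
  forall phi x, K x -> C1_near phi x ->
    (\forall y \near x, K y -> u x - phi x <= u y - phi y) ->
    0 <= u x + H (gradient phi x).

Definition viscosity_solution H K u : Prop :=
  viscosity_subsolution H K u /\ viscosity_supersolution H K u.

End viscosity.

(* Main.v *)
Require Import Defs.
From HB Require Import structures.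
From mathcomp Require Import all_boot all_order all_algebra.
From mathcomp Require Import all_classical all_reals all_analysis.
From mathcomp Require Import measurable_realfun ring lra.

(* The sum S of the coordinates moves with speed 1 - f(a), so the cost of a is
   the Laplace transform of f(a) at 1, and by Tonelli it is monotone in the
   primitive of f(a), which at time u is u - (S(X(u)) - S(x)). The constraint
   S <= k bounds this primitive below by max(0, u - T), where T = k - S(x): it is
   the primitive of the indicator of [T, oo[, whose Laplace transform at 1 is
   exp(-T). Conversely, moving along the diagonal up to time T and resting
   afterwards has exactly this indicator as running cost, and does not leave the
   closed domain because Q is invariant under diagonal translations.
   On the boundary, the supersolution inequality only needs the inward direction
   (1, ..., 1) when S(x) < k, and H >= -1 when S(x) = k. *)

Import Order.TTheory GRing.Theory Num.Theory.
Import numFieldNormedType.Exports.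

Set Implicit Arguments.
Unset Strict Implicit.
Unset Printing Implicit Defensive.

Local Open Scope classical_set_scope.
Local Open Scope ring_scope.

(** * The domain: openness, closure, invariance under diagonal translations *)

Section geometry.
Context {R : realType} {d : nat}.
Implicit Types (x y v : 'rV[R]_d) (k t c : R).

Lemma coord_sumD x y : coord_sum (x + y) = coord_sum x + coord_sum y.
Proof. by rewrite /coord_sum -big_split; apply: eq_bigr => i _; rewrite mxE. Qed.

Lemma coord_sumZ c x : coord_sum (c *: x) = c * coord_sum x.
Proof. by rewrite /coord_sum mulr_sumr; apply: eq_bigr => i _; rewrite mxE. Qed.

Lemma coord_sum_const c : coord_sum (const_mx c : 'rV[R]_d) = d%:R * c.
Proof.
rewrite /coord_sum; under eq_bigr do rewrite mxE.
by rewrite sumr_const card_ord mulr_natl.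
Qed.

Lemma coord_sum_delta i : coord_sum (delta_mx 0 i : 'rV[R]_d) = 1.
Proof.
rewrite /coord_sum (bigD1 i)//= mxE !eqxx big1 ?addr0// => j ji.
by rewrite mxE (negbTE ji).
Qed.

Lemma quad_devZ c x : quad_dev (c *: x) = c ^+ 2 * quad_dev x.
Proof.
rewrite /quad_dev coord_sumZ exprMn mulrBr; congr (_ - _); last by rewrite -mulrA.
rewrite mulr_sumr.
by apply: eq_bigr => i _; rewrite mxE exprMn.
Qed.

(** For [d > 0], Q is the squared Euclidean norm of the component of [x] orthogonal to the diagonal,
    which a diagonal translation does not touch. For [d = 0] all sums are empty. *)
Lemma quad_dev_shift x t : quad_dev (x + const_mx t) = quad_dev x.
Proof.
have [d0|d0] := posnP d.
  by rewrite /quad_dev /coord_sum; subst d; rewrite !big_ord0.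
have dn0 : d%:R != 0 :> R by rewrite pnatr_eq0 -lt0n.
rewrite /quad_dev coord_sumD coord_sum_const.
have -> : \sum_i (x + const_mx t) 0 i ^+ 2 =
    \sum_i x 0 i ^+ 2 + 2 * t * coord_sum x + d%:R * t ^+ 2.
  rewrite /coord_sum mulr_sumr -big_split/=.
  have -> : d%:R * t ^+ 2 = \sum_(i < d) t ^+ 2.
    by rewrite sumr_const card_ord mulr_natl.
  by rewrite -big_split/=; apply: eq_bigr => i _; rewrite !mxE; ring.
by field.
Qed.

Lemma continuous_coord_sum : continuous (@coord_sum R d).
Proof.
apply: (@continuous_big _ _ +%R 0 xpredT add_continuous _ _
  (fun i (x : 'rV[R]_d) => x 0 i)) => i _.
exact: coord_continuous.
Qed.

Lemma continuous_quad_dev : continuous (@quad_dev R d).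
Proof.
have cS : continuous (fun x : 'rV[R]_d => coord_sum x ^+ 2).
  by move=> x; apply: continuousM; exact: continuous_coord_sum.
have cQ : continuous (fun x : 'rV[R]_d => \sum_i x 0 i ^+ 2).
  apply: (@continuous_big _ _ +%R 0 xpredT add_continuous _ _
    (fun i (x : 'rV[R]_d) => x 0 i ^+ 2)) => i _ x.
  by apply: continuousM; exact: coord_continuous.
move=> x; have := @continuousB _ _ _ _ _ x (cQ x).
by apply; apply: continuousM; [exact: cS|exact: cst_continuous].
Qed.

Lemma base_radius_gt0 k : (2 <= d)%N -> 0 < k -> 0 < @base_radius R d k.
Proof.
move=> hd hk; have d2 : 2 <= d%:R :> R by rewrite (ler_nat _ 2).
by rewrite divr_gt0// sqrtr_gt0 mulr_gt0//; lra.
Qed.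

(** A point satisfying the large inequalities is the limit of [(1 - e) *: x] as [e] tends to 0.
    These points lie in [Omega k], because S and Q are homogeneous of degrees 1 and 2 and both
    bounds are positive. *)
Lemma closure_Omega k : (2 <= d)%N -> 0 < k ->
  closure (@Omega R d k) =
  [set x | `|coord_sum x| <= k /\ quad_dev x <= @base_radius R d k ^+ 2].
Proof.
move=> hd hk; have r0 := base_radius_gt0 hd hk.
apply/seteqP; split => [x Ox|x [Sx Qx] B Bx].
  split.
    have cl : closed [set z | `|@coord_sum R d z| <= k].
      apply: (@preimage_closed _ _ (fun z => `|coord_sum z|) [set z | z <= k]);
        last exact: closed_le.
      by move=> z _; apply: (@continuous_comp _ _ _ (@coord_sum R d) Num.norm);
        [exact: continuous_coord_sum|exact: norm_continuous].
    by apply: cl; apply: closureS Ox => z [/ltW].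
  have cl r : closed [set z | @quad_dev R d z <= r].
    apply: (@preimage_closed _ _ _ [set z | z <= r]); last exact: closed_le.
    by move=> z _; exact: continuous_quad_dev.
  by apply: cl; apply: closureS Ox => z [_ /ltW].
have cvx : (fun e : R => (1 - e) *: x) @ 0 --> x.
  rewrite -[X in _ --> X]scale1r -{2}(subr0 1).
  by apply: cvgZr_tmp; apply: cvgB; [exact: cvg_cst|exact: cvg_id].
have /nbhs_ballP[e /= e0 Be] := cvx _ Bx.
(* Halving keeps [e'] strictly inside the ball of radius [e]; the cap at 1 keeps the factor [1 - e']
   nonnegative. *)
pose e' := Num.min (e / 2) 1.
have e'0 : 0 < e' by rewrite lt_min ltr01 divr_gt0.
have e'1 : e' <= 1 by rewrite ge_min lexx orbT.
have e'e : e' < e by rewrite gt_min ltr_pdivrMr// ltr_pMr// ltr1n.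
exists ((1 - e') *: x); split; last first.
  by apply: Be; rewrite /ball/= sub0r normrN gtr0_norm.
split.
  rewrite coord_sumZ normrM ger0_norm ?subr_ge0//.
  by nra.
rewrite quad_devZ; have := exprn_gt0 2 r0.
have : 0 <= (1 - e') ^+ 2 by rewrite sqr_ge0.
have : (1 - e') ^+ 2 < 1 by nra.
by move: (base_radius k ^+ 2) ((1 - e') ^+ 2) Qx => r2 c2 ? ? ? ?; nra.
Qed.

Lemma open_Omega k : open (@Omega R d k).
Proof.
apply: openI.
  apply: (@open_comp _ _ (fun z => `|coord_sum z|) [set z | z < k]);
    last exact: open_lt.
  by move=> z _; apply: (@continuous_comp _ _ _ (@coord_sum R d) Num.norm);
    [exact: continuous_coord_sum|exact: norm_continuous].
apply: (@open_comp _ _ _ [set z | z < base_radius k ^+ 2]); last exact: open_lt.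
by move=> z _; exact: continuous_quad_dev.
Qed.

End geometry.

(** * The Hamiltonian in closed form, and lower bounds for it *)

Section hamiltonian.
Context {R : realType} {d : nat}.
Implicit Type p : 'rV[R]_d.

Lemma hamiltonianE p : hamiltonian p = d%:R^-1 * \sum_i (`|p 0 i - 1| - 1).
Proof.
have HE (c : 'rV[R]_d) :
    - (\sum_i (c 0 i / d%:R) * p 0 i) - running_cost c =
    d%:R^-1 * \sum_i (c 0 i * (1 - p 0 i) - 1).
  rewrite /running_cost !mulr_sumr -opprD -big_split -sumrN /=.
  by apply: eq_bigr => i _; ring.
have le_max (c : 'rV[R]_d) : controlSet c ->
    d%:R^-1 * \sum_i (c 0 i * (1 - p 0 i) - 1) <=
    d%:R^-1 * \sum_i (`|p 0 i - 1| - 1).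
  move=> cA; rewrite ler_wpM2l ?invr_ge0// ler_sum// => i _; rewrite lerD2r.
  rewrite distrC (le_trans (ler_norm _))// normrM ler_piMl//.
  by rewrite ler_norml cA.
(* The maximisation splits over the coordinates, and the sign of [1 - p 0 i] maximises the product
   with [1 - p 0 i] over [-1, 1]. *)
pose c : 'rV[R]_d := \row_i Num.sg (1 - p 0 i).
have cA : controlSet c by move=> i; rewrite mxE -ler_norml normr_sg; case: eqP.
rewrite /hamiltonian; apply/eqP; rewrite eq_le; apply/andP; split.
  apply: ge_sup; first by eexists; exists c.
  by move=> _ [c' c'A <-]; rewrite HE; exact: le_max.
apply: ub_le_sup.
  eexists => _ [c' c'A <-]; rewrite HE; exact: le_max.
exists c => //; rewrite HE; congr (_ * _); apply: eq_bigr => i _.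
by rewrite mxE distrC [in RHS]normrEsg.
Qed.

(** This is the bound given by the control 0, of running cost 1. It serves on the face S = k, where
    the candidate solution equals 1. *)
Lemma hamiltonian_geN1 p : (0 < d)%N -> -1 <= hamiltonian p.
Proof.
move=> d0; rewrite hamiltonianE.
rewrite [leLHS](_ : _ = d%:R^-1 * \sum_(i < d) (-1)); last first.
  by rewrite sumr_const card_ord -[X in _ * X]mulr_natl mulrA mulVf ?mul1r//
    pnatr_eq0 -lt0n.
rewrite ler_wpM2l ?invr_ge0// ler_sum// => i _.
by have := normr_ge0 (p 0 i - 1); lra.
Qed.

(** This is the bound given by the control (1, ..., 1), of running cost 0. *)
Lemma hamiltonian_ge p : (0 < d)%N -> - (d%:R^-1 * coord_sum p) <= hamiltonian p.
Proof.
move=> d0; rewrite hamiltonianE -mulrN ler_wpM2l ?invr_ge0// -sumrN ler_sum//.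
by move=> i _; have := ler_norm (1 - p 0 i); rewrite distrC; lra.
Qed.

Lemma hamiltonian_const c : (0 < d)%N -> c <= 1 ->
  hamiltonian (const_mx c : 'rV[R]_d) = - c.
Proof.
move=> d0 c1; rewrite hamiltonianE; under eq_bigr do rewrite mxE.
rewrite sumr_const card_ord -[X in _ * X]mulr_natl mulrA mulVf ?mul1r ?pnatr_eq0 -?lt0n//.
by rewrite distrC ger0_norm ?subr_ge0//; ring.
Qed.

End hamiltonian.

(** * Minima along a ray *)

Section one_sided_minimum.
Context {R : realType} {V : normedModType R}.

(** The difference quotients are nonnegative for small positive [t]. The hypothesis is one-sided
    because at a boundary point of the domain only the inward half of the line can be used. *)
Lemma derive_ge0_min (f : V -> R) (x v : V) : derivable f x v ->
  (\forall t \near 0^'+, f x <= f (t *: v + x)) -> 0 <= 'D_v f x.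
Proof.
move=> dfx minf.
have : h^-1 *: (f (h *: v + x) - f x) @[h --> 0^'+] --> 'D_v f x.
  apply: cvg_trans dfx; apply: cvg_app; apply: within_subset => //.
by move=> y /= y0; rewrite gt_eqF.
move/cvgr_to_ge; apply; near=> t.
rewrite mulr_ge0 ?invr_ge0//.
by rewrite subr_ge0; near: t.
Unshelve. all: by end_near. Qed.

Lemma near_ray (P : V -> Prop) (x v : V) :
  (\forall y \near x, P y) -> \forall t \near 0^'+, P (t *: v + x).
Proof.
move=> Px; have : t *: v + x @[t --> (0 : R)^'+] --> x.
  apply: cvg_at_right_filter; rewrite -[X in _ --> X]add0r -[X in _ --> X + _](scale0r v).
  by apply: cvgD; [exact: scalel_continuous|exact: cvg_cst].
by move=> /(_ _ Px).
Qed.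

End one_sided_minimum.

(** * The exponential as a viscosity sub- and supersolution *)

Section exponential.
Context {R : realType} {d : nat}.
Implicit Types (x v p : 'rV[R]_d) (phi : 'rV[R]_d -> R) (k : R).

Lemma differentiable_coord_sum x : differentiable (@coord_sum R d) x.
Proof.
have -> : @coord_sum R d = \sum_(i < d) (fun y : 'rV[R]_d => y 0 i).
  by apply/funext => y; rewrite fct_sumE.
by apply: differentiable_sum => i; exact: differentiable_coord.
Qed.

Lemma derive_coord_sum x v : 'D_v coord_sum x = coord_sum v.
Proof.
apply: cvg_lim => //; apply: cvg_near_cst; near=> t.
rewrite /= coord_sumD addrK coord_sumZ /GRing.scale/= mulKf//.
by near: t; exact: nbhs_dnbhs_neq.
Unshelve. all: by end_near. Qed.

Lemma is_derive_expR_coord_sum k x v :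
  is_derive x v (fun y => expR (coord_sum y - k))
    (coord_sum v * expR (coord_sum x - k)).
Proof.
have dS : differentiable (fun y : 'rV[R]_d => coord_sum y - k) x.
  by apply: differentiableB => //; exact: differentiable_coord_sum.
have dE : differentiable (@expR R) (coord_sum x - k).
  exact/derivable1_diffP/derivable_expR.
have dc := differentiable_comp dS dE.
apply: DeriveDef; first exact: diff_derivable.
rewrite -[fun y => _]/(expR \o (fun y : 'rV[R]_d => coord_sum y - k)) deriveE//.
rewrite diff_comp//= diff1E// derive1E.
rewrite (@derive_val _ _ _ _ _ _ _ (is_derive_expR _)) -deriveE// deriveB//.
- by rewrite derive_cst subr0 derive_coord_sum.
- exact/diff_derivable/differentiable_coord_sum.
Qed.

Lemma continuous_expR_coord_sum k :
  continuous (fun y : 'rV[R]_d => expR (coord_sum y - k)).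
Proof.
move=> x; apply: differentiable_continuous; apply: (@differentiable_comp _ _ _ _
  (fun y : 'rV[R]_d => coord_sum y - k) expR).
  by apply: differentiableB => //; exact: differentiable_coord_sum.
exact/derivable1_diffP/derivable_expR.
Qed.

(** The differential is linear and the diagonal is the sum of the basis vectors. This turns a
    derivative along the diagonal into the quantity appearing in [hamiltonian_ge]. *)
Lemma coord_sum_gradient phi x : differentiable phi x ->
  coord_sum (gradient phi x) = 'D_(const_mx 1) phi x.
Proof.
move=> dphi; rewrite deriveE// /coord_sum.
have -> : const_mx 1 = \sum_i delta_mx 0 i :> 'rV[R]_d.
  apply/rowP => j; rewrite mxE summxE (bigD1 j)//= mxE !eqxx/=.
  by rewrite big1 ?addr0// => i ij; rewrite mxE eq_sym (negbTE ij) andbF.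
by rewrite linear_sum; apply: eq_bigr => i _; rewrite mxE deriveE.
Qed.

(** The set [K] is abstract so that the open domain and its closure are both covered; the last
    hypothesis says that the diagonal points inward wherever S < k. *)
Lemma expR_supersolution k (K : set 'rV[R]_d) : (0 < d)%N ->
  (forall x, K x -> coord_sum x <= k) ->
  (forall x, K x -> coord_sum x < k ->
     \forall t \near 0^'+, K (t *: const_mx 1 + x)) ->
  viscosity_supersolution hamiltonian K (fun x => expR (coord_sum x - k)).
Proof.
move=> d0 Kk Kray; split.
  by apply: continuous_subspaceT; exact: continuous_expR_coord_sum.
move=> phi x Kx C1 minx; have [dphi _] := nbhs_singleton C1.
have [Sk|kS] := ltP (coord_sum x) k; last first.
  have -> : coord_sum x = k by apply/eqP; rewrite eq_le kS Kk.
  by rewrite subrr expR0; have := hamiltonian_geN1 (gradient phi x) d0; lra.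
have du := is_derive_expR_coord_sum k x (const_mx 1).
have dphi1 : derivable phi x (const_mx 1) by exact: diff_derivable.
(* Minimality along the diagonal bounds the sum of the partial derivatives of [phi] by [d] times
   u(x). *)
have : 0 <= 'D_(const_mx 1) ((fun y => expR (coord_sum y - k)) - phi) x.
  apply: derive_ge0_min; first exact: derivableB.
  near=> t; apply: (near (near_ray (const_mx 1) minx) t) => //.
  by near: t; exact: Kray.
rewrite deriveB// derive_val -coord_sum_gradient// coord_sum_const mulr1 => uD.
have := hamiltonian_ge (gradient phi x) d0.

have : d%:R^-1 * coord_sum (gradient phi x) <= expR (coord_sum x - k).
  by rewrite ler_pdivrMl ?ltr0n//; lra.
lra.
Unshelve. all: by end_near. Qed.

(** In an open set every direction is allowed, which forces the gradient of [phi] to be that of u,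
    the constant vector u(x). As u(x) <= 1, [hamiltonian_const] gives H = - u(x). *)
Lemma expR_subsolution k (K : set 'rV[R]_d) : (0 < d)%N ->
  open K -> (forall x, K x -> coord_sum x <= k) ->
  viscosity_subsolution hamiltonian K (fun x => expR (coord_sum x - k)).
Proof.
move=> d0 oK Kk; split.
  by apply: continuous_subspaceT; exact: continuous_expR_coord_sum.
move=> phi x Kx C1 maxx; have [dphi _] := nbhs_singleton C1.
have Dv v : coord_sum v * expR (coord_sum x - k) <= 'D_v phi x.
  have du := is_derive_expR_coord_sum k x v.
  have dphiv : derivable phi x v by exact: diff_derivable.
  have : 0 <= 'D_v (phi - (fun y => expR (coord_sum y - k))) x.
    apply: derive_ge0_min; first exact: derivableB.
    near=> t; have := near (near_ray v maxx) t; rewrite -lerN2 !opprB; apply => //.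
    by near: t; apply: near_ray; exact: open_nbhs_nbhs.
  by rewrite deriveB// derive_val subr_ge0.
(* The directions [- delta_mx 0 i] and [delta_mx 0 i] give the two inequalities for each partial
   derivative. *)
have -> : gradient phi x = const_mx (expR (coord_sum x - k)).
  apply/rowP => i; rewrite !mxE; apply/eqP; rewrite eq_le; apply/andP; split.
    have := Dv (- delta_mx 0 i); rewrite deriveE// linearN -deriveE//.
    by rewrite -scaleN1r coord_sumZ coord_sum_delta; lra.
  by have := Dv (delta_mx 0 i); rewrite coord_sum_delta mul1r.
by rewrite hamiltonian_const ?expR_le1 ?subr_le0 ?Kk// subrr.
Unshelve. all: by end_near. Qed.

End exponential.

(** * Completed Lebesgue measure, and Laplace transforms by Tonelli *)

Section lebesgue.
Context {R : realType}.
Local Notation leb := (@completed_lebesgue_measure R).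
Local Notation mu := (@lebesgue_measure R).

Lemma measurable_id_lebesgueR :
  measurable_fun setT (idfun : lebesgueR R -> R).
Proof. by move=> _ A mA; rewrite setTI; exact: sub_caratheodory. Qed.

Lemma measurable_lebesgueR (A : set R) :
  measurable A -> measurable (A : set (lebesgueR R)).
Proof. exact: sub_caratheodory. Qed.

(** The identity is measurable from the completed sigma-algebra to the Borel one and pushes the
    completed measure forward to Lebesgue measure. Explicit Borel integrands can thus be integrated
    by the fundamental theorem of calculus. *)
Lemma ge0_integral_lebesgueR (D : set R) (f : R -> \bar R) :
  measurable D -> measurable_fun D f -> (forall x, D x -> 0 <= f x)%E ->
  (\int[leb]_(x in D) f x = \int[mu]_(x in D) f x)%E.
Proof.
move=> mD mf f0.
rewrite -(@ge0_integral_pushforward _ _ (lebesgueR R) (measurableTypeR R) _ idfun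
  measurable_id_lebesgueR leb D f)//.
by move=> x; rewrite inE; exact: f0.
Qed.

Lemma integral_expRN (a : R) :
  (\int[mu]_(x in `[a, +oo[) (expR (- x))%:E = (expR (- a))%:E)%E.
Proof.
rewrite (@ge0_continuous_FTC2y _ (fun x => expR (- x)) (fun x => - expR (- x)) _ 0).
- by rewrite sub0e -EFinN opprK.
- by move=> x _; exact: expR_ge0.
- apply: continuous_subspaceT => x.
  by apply: (@continuous_comp _ _ _ (@GRing.opp R) expR);
    [exact: opp_continuous|exact: continuous_expR].
- by rewrite -oppr0; apply: cvgN; exact: cvgr_expR.
- by move=> x _; exact: ex_derive.
- apply: cvg_at_right_filter; apply: cvgN.
  by apply: (@continuous_comp _ _ _ (@GRing.opp R) expR);
    [exact: opp_continuous|exact: continuous_expR].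
- by move=> x _; rewrite derive1E derive_val; rewrite /GRing.scale/=; ring.
Qed.

(** Write exp(-t) as the integral of exp(-u) over u >= t, then exchange the two integrations. *)
Lemma laplace_tonelli (g : R -> R) :
  measurable_fun (`[0, +oo[ : set (lebesgueR R)) (g : lebesgueR R -> R) ->
  (forall t, 0 <= t -> 0 <= g t) ->
  (\int[leb]_(t in `[0%R, +oo[) (expR (- t) * g t)%:E =
   \int[mu]_(u in `[0%R, +oo[)
      ((expR (- u))%:E * \int[leb]_(t in `[0%R, u]) (g t)%:E))%E.
Proof.
move=> mg g0.
have mI : measurable (`[0, +oo[ : set (lebesgueR R)).
  exact: measurable_lebesgueR.
(* Extension by 0 makes the integrand nonnegative and measurable on the whole product, as Tonelli
   requires. *)
pose g' : lebesgueR R -> R := g \_ `[0, +oo[.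
have mg' : measurable_fun setT g' by apply/(measurable_restrictT _ _).1.
have g'0 t : 0 <= g' t.
  by rewrite /g' patchE; case: ifPn => // /[!inE]/=; rewrite in_itv/= andbT => /g0.
pose A : set (lebesgueR R * measurableTypeR R) := [set z | z.1 <= z.2].
have mA : measurable A.
  rewrite -[A]setTI; apply: measurable_fun_le => //.
  by apply: (measurableT_comp measurable_id_lebesgueR); exact: measurable_fst.
have AE z : \1_A z = ((z.1 : R) <= z.2)%R%:R :> R.
  by rewrite indicE; congr (nat_of_bool _)%:R; apply/idP/idP; rewrite inE.
pose h (z : lebesgueR R * measurableTypeR R) : \bar R :=
  (expR (- z.2) * g' z.1 * \1_A z)%:E.
have mh : measurable_fun setT h.
  apply/measurable_EFinP; apply: measurable_funM; last exact: measurable_indic.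
  apply: measurable_funM.
    apply: (measurableT_comp (@measurable_expR R)).
    by apply: measurableT_comp => //; exact: measurable_snd.
  by apply: measurableT_comp => //; exact: measurable_fst.
have h0 z : (0 <= h z)%E by rewrite lee_fin !mulr_ge0 ?expR_ge0.
have := @fubini_tonelli _ _ (lebesgueR R) (measurableTypeR R) _ leb mu h mh h0.
rewrite /fubini_F /fubini_G /= => E.
(* Integrating in [y] first restores the weight exp(-t). *)
transitivity (\int[leb]_x \int[mu]_y h (x, y))%E.
  rewrite integral_mkcond; apply: eq_integral => t _.
  have -> : (fun y => h (t, y)) =
      (fun y => (g' t)%:E *
        ((fun y : R => (expR (- y))%:E) \_ (`[t : R, +oo[ : set R)) y)%E.
    apply/funext => y; rewrite /h AE patchE mem_setE in_itv/= andbT.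
    by case: (t <= y); rewrite ?mulr0 ?mule0// mulr1 mulrC EFinM.
  rewrite ge0_integralZl//; last 3 first.
  - apply/(measurable_restrictT _ _).1 => //; apply/measurable_EFinP.
    by apply: (measurableT_comp (@measurable_expR R)).
  - by move=> y _; rewrite patchE; case: ifPn => // _; rewrite lee_fin expR_ge0.
  - by rewrite lee_fin.
  rewrite -integral_mkcond integral_expRN /g' !patchE.
  by case: ifPn => _; rewrite ?mul0e// muleC.
(* Integrating in the first variable yields the primitive of [g] at [u]. *)
have IG (u : R) : (\int[leb]_x h (x, u) =
    (expR (- u))%:E * \int[leb]_(t in `[0%R, u]) (g t)%:E)%E.
  have -> : (fun x => h (x, u)) =
      (fun x => (expR (- u))%:E *
        ((fun t : lebesgueR R => (g t)%:E) \_ (`[0%R, u : R] : set R)) x)%E.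
    apply/funext => x; rewrite /h AE patchE mem_setE in_itv/=.
    rewrite /g' patchE mem_setE in_itv/= andbT.
    case: (0 <= x) => /=; last by rewrite mulr0 mul0r mule0.
    by case: (x <= u); rewrite ?mulr0 ?mule0// mulr1 EFinM.
  rewrite ge0_integralZl//; last 2 first.
  - apply/(measurable_restrictT _ _).1; first exact: measurable_lebesgueR.
    apply/measurable_EFinP; apply: measurable_funS mg => //.
    by move=> x /=; rewrite !in_itv/= andbT => /andP[].
  - move=> x _; rewrite patchE mem_setE in_itv/=; case: ifPn => // /andP[x0 _].
    by rewrite lee_fin g0.
  by rewrite -integral_mkcond.
rewrite E; rewrite [RHS]integral_mkcond; apply: eq_integral => u _.
rewrite patchE IG; case: ifPn => //; rewrite notin_setE/= in_itv/= andbT => /negP.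
rewrite -ltNge => u0.
(* For [u < 0] the primitive is an integral over the empty set, in agreement with the restriction of
   the right-hand side to u >= 0. *)
have -> : `[0, u]%classic = set0 :> set (lebesgueR R).
  by rewrite set_itv_ge// bnd_simp -ltNge.
by rewrite integral_set0 mule0.
Qed.

End lebesgue.

Section le_integral.
Local Open Scope ereal_scope.
Import HBNNSimple.

(* [ge0_le_integral] without its measurability hypotheses. *)
Lemma nonneg_le_integral d (T : measurableType d) (R : realType)
    (mu : {measure set T -> \bar R}) (D : set T) (f g : T -> \bar R) :
  (forall x, D x -> 0 <= f x) -> (forall x, D x -> f x <= g x) ->
  \int[mu]_(x in D) f x <= \int[mu]_(x in D) g x.
Proof.
move=> f0 fg; have g0 x : D x -> 0 <= g x.
  by move=> Dx; exact: le_trans (f0 _ Dx) (fg _ Dx).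
rewrite !ge0_integralE//; apply: ereal_sup_le => _ [h hf <-].
exists h => // x.
rewrite (le_trans (hf x))// !patchE; case: ifPn => //.
by rewrite inE; exact: fg.
Qed.

End le_integral.

(** * The extremal running cost, and comparison of Laplace transforms *)

Section step.
Context {R : realType}.
Local Notation leb := (@completed_lebesgue_measure R).
Implicit Types (t u T : R).

(** The running cost of the optimal control: free motion before [T], rest at unit cost
    afterwards. *)
Definition step T : R -> R := \1_(`[T, +oo[ : set R).

Lemma stepE T t : step T t = (T <= t)%R%:R.
Proof. by rewrite /step indicE mem_setE in_itv/= andbT. Qed.

Lemma step_ge0 T t : 0 <= step T t.
Proof. by rewrite stepE. Qed.

Lemma measurable_step T (D : set R) :
  measurable_fun (D : set (lebesgueR R)) (step T : lebesgueR R -> R).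
Proof.
by apply: measurable_funTS; apply: measurable_indic; exact: measurable_lebesgueR.
Qed.

Lemma completed_lebesgue_measure_itvcc t u :
  t <= u -> leb (`[t, u] : set R) = (u - t)%:E.
Proof.
(* Both measures restrict the same outer measure, so they agree on this interval by conversion. *)
move=> tu; rewrite -[LHS]/(@lebesgue_measure R `[t, u]) lebesgue_measure_itv/= lte_fin.
case: ltgtP tu => // -> _; by rewrite subrr.
Qed.

Lemma integral_step T u : 0 <= T ->
  (\int[leb]_(t in `[0%R, u]) (step T t)%:E = (Num.max 0 (u - T))%:E)%E.
Proof.
move=> T0; rewrite integral_indic; last 2 first.
- exact: measurable_lebesgueR.
- exact: measurable_lebesgueR.
have [uT|Tu] := ltP u T.
  have -> : `[T, +oo[ `&` `[0, u] = set0 :> set R.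
    apply/seteqP; split => // t /= []; rewrite !in_itv/= andbT => Tt /andP[_ tu].
    by have := lt_le_trans uT (le_trans Tt tu); rewrite ltxx.
  by rewrite measure0 max_l// subr_le0 ltW.
have -> : `[T, +oo[ `&` `[0, u] = `[T, u]%classic :> set R.
  apply/seteqP; split => t /=; rewrite !in_itv/= andbT; first by case=> -> /andP[].
  by move=> /andP[Tt ->]; rewrite Tt (le_trans T0 Tt).
by apply: (eq_trans (completed_lebesgue_measure_itvcc Tu)); rewrite max_r// subr_ge0.
Qed.

Lemma integral_expRN_step T : 0 <= T ->
  (\int[leb]_(t in `[0%R, +oo[) (expR (- t) * step T t)%:E = (expR (- T))%:E)%E.
Proof.
move=> T0.
transitivity (\int[leb]_(t in (`[0%R, +oo[ `&` `[T, +oo[)%classic) (expR (- t))%:E)%E.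
  rewrite integral_mkcondr; apply: eq_integral => t _.
  by rewrite patchE mem_setE in_itv/= andbT stepE; case: ifP; rewrite ?mulr1 ?mulr0.
have -> : `[0, +oo[ `&` `[T, +oo[ = `[T, +oo[%classic :> set R.
  apply/seteqP; split => t /=; rewrite !in_itv/= !andbT; first by case.
  by move=> Tt; split => //; exact: le_trans Tt.
rewrite ge0_integral_lebesgueR//; first exact: integral_expRN.
  by apply/measurable_EFinP; apply: measurable_funTS;
    apply: (measurableT_comp (@measurable_expR R)).
Qed.

(** Only primitives are compared: the state constraint bounds the accumulated running cost, not its
    value at each time. *)
Lemma laplace_le (f g : R -> R) :
  measurable_fun (`[0, +oo[ : set (lebesgueR R)) (f : lebesgueR R -> R) ->
  measurable_fun (`[0, +oo[ : set (lebesgueR R)) (g : lebesgueR R -> R) ->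
  (forall t, 0 <= t -> 0 <= f t) -> (forall t, 0 <= t -> 0 <= g t) ->
  (forall u, 0 <= u -> (\int[leb]_(t in `[0%R, u]) (f t)%:E <=
                        \int[leb]_(t in `[0%R, u]) (g t)%:E)%E) ->
  (\int[leb]_(t in `[0%R, +oo[) (expR (- t) * f t)%:E <=
   \int[leb]_(t in `[0%R, +oo[) (expR (- t) * g t)%:E)%E.
Proof.
move=> mf mg f0 g0 fg; rewrite !laplace_tonelli//.
have Lf0 (h : R -> R) : (forall t, 0 <= t -> 0 <= h t) -> forall u : R,
    (0 <= (expR (- u))%:E * \int[leb]_(t in `[0%R, u]) (h t)%:E)%E.
  move=> h0 u; rewrite mule_ge0 ?lee_fin ?expR_ge0//.
  by apply: integral_ge0 => t /=; rewrite in_itv/= => /andP[t0 _]; rewrite lee_fin h0.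
(* This form of monotonicity avoids proving that the primitives are measurable in [u]. *)
apply: nonneg_le_integral => [u _|u]; first exact: Lf0.
by rewrite /= in_itv/= andbT => u0; rewrite lee_wpmul2l ?lee_fin ?expR_ge0// fg.
Qed.

End step.

(** * Costs of controls: the lower bound and the optimal control *)

Section trajectory.
Context {R : realType} {d : nat}.
Local Notation leb := (@completed_lebesgue_measure R).
Implicit Types (x : 'rV[R]_d) (a : R -> 'rV[R]_d) (t u T : R).

Lemma control_integrable a i u : control a ->
  leb.-integrable (`[0%R, u] : set R) (EFin \o (fun t => a t 0 i)).
Proof.
move=> [aA ma]; apply: measurable_bounded_integrable.
- exact: measurable_lebesgueR.
- have [u0|u0] := leP 0 u; first by
    rewrite [ltLHS](completed_lebesgue_measure_itvcc u0) ltry.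
  by rewrite set_itv_ge ?measure0// bnd_simp -ltNge.
- apply: measurable_funS (ma i); first exact: measurable_lebesgueR.
  by move=> t /=; rewrite !in_itv/= andbT => /andP[].
- exists 1; split => // M M1 t /=; rewrite in_itv/= => /andP[t0 _].
  by rewrite (le_trans _ (ltW M1))// ler_norml; exact: aA.
Qed.

(** The running cost is 1 minus the mean of the coordinates of [a], and this mean is the speed of S
    along the trajectory. *)
Lemma integral_running_cost x a u : (0 < d)%N -> control a -> 0 <= u ->
  (\int[leb]_(t in `[0%R, u]) (running_cost (a t))%:E =
   (u - (coord_sum (trajectory x a u) - coord_sum x))%:E)%E.
Proof.
move=> d0 ca u0.
have mI : measurable (`[0%R, u] : set (lebesgueR R)) by exact: measurable_lebesgueR.
have int1 : leb.-integrable (`[0%R, u] : set R) (EFin \o cst 1).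
  apply: measurable_bounded_integrable => //.
  - by rewrite [ltLHS](completed_lebesgue_measure_itvcc u0) ltry.
  - exists 1; split => // M M1 t _ /=; rewrite normr1; exact: ltW.
have inta i := control_integrable i u ca.
pose F (i : 'I_d) (t : lebesgueR R) := d%:R^-1 * (1 - a t 0 i).
have iF i : leb.-integrable (`[0%R, u] : set R) (EFin \o F i).
  exact: (integrableZl mI d%:R^-1 (integrableB mI int1 (inta i))).
(* Integrability makes the integral finite, so it can be computed with the real-valued integral used
   in [trajectory]. *)
have FE i : (\int[leb]_(t in `[0%R, u]) (F i t)%:E =
   (d%:R^-1 * (u - \int[leb]_(t in `[0%R, u]) (a t 0 i))%R)%:E)%E.
  rewrite -[LHS]fineK; last exact: integrable_fin_num (iF i).
  congr EFin; rewrite [LHS](RintegralZl _ mI (integrableB mI int1 (inta i))).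
  rewrite (RintegralB mI int1 (inta i)) Rintegral_cst// mul1r.
  by rewrite [X in fine X](completed_lebesgue_measure_itvcc u0) subr0.
under eq_integral do rewrite /running_cost mulr_sumr -sumEFin.
rewrite integral_sum//.
under eq_bigr do rewrite FE.
rewrite sumEFin; congr EFin.
rewrite -mulr_sumr sumrB sumr_const card_ord -[u *+ d]mulr_natl mulrBr mulKf;
  last by rewrite pnatr_eq0 -lt0n.
rewrite /trajectory coord_sumD coord_sumZ (addrC (coord_sum x)) addrK; congr (_ - _ * _).
by apply: eq_bigr => i _; rewrite mxE.
Qed.

Lemma running_cost_ge0 (c : 'rV[R]_d) : controlSet c -> 0 <= running_cost c.
Proof.
move=> cA; rewrite mulr_ge0 ?invr_ge0// sumr_ge0// => i _.
by have /andP[] := cA i; rewrite subr_ge0.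
Qed.

Lemma measurable_running_cost a : control a ->
  measurable_fun (`[0, +oo[ : set (lebesgueR R))
    ((fun t => running_cost (a t)) : lebesgueR R -> R).
Proof.
move=> [_ ma]; apply: measurable_funM => //.
apply: measurable_sum => i; apply: measurable_funB => //.
Qed.

Lemma cost_ge x a k : (0 < d)%N -> control a -> coord_sum x <= k ->
  (forall u, 0 <= u -> coord_sum (trajectory x a u) <= k) ->
  ((expR (coord_sum x - k))%:E <= cost a)%E.
Proof.
move=> d0 ca xk trk; have T0 : 0 <= k - coord_sum x by rewrite subr_ge0.
rewrite -opprB -integral_expRN_step//; apply: laplace_le.
- exact: measurable_step.
- exact: measurable_running_cost.
- by move=> t _; exact: step_ge0.
- by move=> t t0; apply: running_cost_ge0; apply: ca.1.
move=> u u0; rewrite integral_step// (integral_running_cost x)// lee_fin.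
(* The bound by [u - T] is the constraint S <= k at time [u]; the bound by 0 is the nonnegativity of
   the running cost. *)
rewrite ge_max; apply/andP; split; last by have := trk _ u0; lra.
rewrite -lee_fin -integral_running_cost//; apply: integral_ge0 => t /=.
by rewrite in_itv/= => /andP[t0 _]; rewrite lee_fin running_cost_ge0//; apply: ca.1.
Qed.

(** S grows at unit speed until [T], so [T = k - coord_sum x] is the arrival time on the face S =
    k. *)
Definition diagonal_then_rest T t : 'rV[R]_d := const_mx (1 - step T t).

Lemma running_cost_diagonal_then_rest T t : (0 < d)%N ->
  running_cost (diagonal_then_rest T t) = step T t.
Proof.
move=> d0; rewrite /running_cost; under eq_bigr do rewrite mxE opprB addrC subrK.
rewrite sumr_const card_ord -[X in _ * X]mulr_natl mulKf//.
by rewrite pnatr_eq0 -lt0n.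
Qed.

Lemma control_diagonal_then_rest T : control (diagonal_then_rest T).
Proof.
split=> [t _ i|i].
  by rewrite mxE stepE; case: (T <= t); rewrite ?subrr ?subr0; lra.
have -> : (fun t => diagonal_then_rest T t 0 i) = (fun t => 1 - step T t).
  by apply/funext => t; rewrite mxE.
by apply: measurable_funB => //; exact: measurable_step.
Qed.

(** The shift may stay unspecified, since Q ignores it; its effect on S is found separately. *)
Lemma trajectory_diagonal_then_rest x T u : exists c,
  trajectory x (diagonal_then_rest T) u = x + const_mx c.
Proof.
exists (d%:R^-1 * \int[leb]_(s in `[0, u]) (1 - step T s))%R.
congr (x + _); apply/rowP => i; rewrite !mxE; congr (_ * _).
by apply: eq_Rintegral => s _; rewrite mxE.
Qed.

(** The accumulated cost is known to be max(0, u - T), and [integral_running_cost] read backwards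
    gives the displacement u - max(0, u - T) = min(u, T). *)
Lemma coord_sum_diagonal_then_rest x T u : (0 < d)%N -> 0 <= T -> 0 <= u ->
  coord_sum (trajectory x (diagonal_then_rest T) u) =
  coord_sum x + Num.min u T.
Proof.
move=> d0 T0 u0.
have := integral_running_cost x d0 (control_diagonal_then_rest T) u0.
under eq_integral do rewrite running_cost_diagonal_then_rest//.
rewrite integral_step// => -[].
by have [uT|Tu] := ltP u T; case: (leP 0 (u - T)); lra.
Qed.

Lemma cost_diagonal_then_rest T : (0 < d)%N -> 0 <= T ->
  cost (diagonal_then_rest T) = (expR (- T))%:E.
Proof.
move=> d0 T0; rewrite -integral_expRN_step//; apply: eq_integral => t _.
by rewrite running_cost_diagonal_then_rest.
Qed.

End trajectory.

(** * The value function and the viscosity properties on the given domain *)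

Theorem mainTheorem8 (R : realType) (d : nat) (k : R)
    (hd : (2 <= d)%N) (hk : 0 < k) :
  let u_k := fun x : 'rV[R]_d => expR (coord_sum x - k) in
  [/\ forall x, closure (Omega k) x ->
        value_function (closure (Omega k)) x = (u_k x)%:E,
      forall p : 'rV[R]_d,
        hamiltonian p = d%:R^-1 * \sum_i (`|p 0 i - 1| - 1),
      viscosity_solution hamiltonian (Omega k) u_k &
      viscosity_supersolution hamiltonian (closure (Omega k)) u_k].
Proof.
have d0 : (0 < d)%N by exact: ltnW.
have Omega_le (x : 'rV[R]_d) : Omega k x -> coord_sum x <= k.
  by move=> [Sx _]; rewrite (le_trans (ler_norm _))// ltW.
split.
- move=> x Kx; rewrite closure_Omega//; move: (Kx); rewrite closure_Omega// => -[Sx Qx].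
  have /andP[kS Sk] : - k <= coord_sum x <= k by rewrite -ler_norml.
  have T0 : 0 <= k - coord_sum x by rewrite subr_ge0.
  apply/eqP; rewrite eq_le; apply/andP; split.
    apply: ge_ereal_inf; exists (cost (@diagonal_then_rest R d (k - coord_sum x))).
      exists (diagonal_then_rest (k - coord_sum x)) => //.
      split; first exact: control_diagonal_then_rest.
      move=> t t0; split; last first.
        by have [c ->] := trajectory_diagonal_then_rest x (k - coord_sum x) t;
          rewrite quad_dev_shift.
      (* S starts at or above -k, never decreases, and stops at k. *)
      rewrite coord_sum_diagonal_then_rest// ler_norml.
      by have [] := leP t (k - coord_sum x) => ?; apply/andP; split; lra.
    by rewrite cost_diagonal_then_rest// opprB.
  apply: le_ereal_inf_tmp => _ [a [ca tra] <-]; apply: (cost_ge d0 ca Sk) => t t0.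
  by have [St _] := tra t t0; rewrite (le_trans (ler_norm _)).
- exact: hamiltonianE.
- split; first by apply: expR_subsolution => //; exact: open_Omega.
  apply: expR_supersolution => // x Ox _; apply: near_ray.
  by apply: open_nbhs_nbhs; split => //; exact: open_Omega.
- apply: expR_supersolution => //; rewrite closure_Omega//.
    by move=> x [Sx _]; rewrite (le_trans (ler_norm _)).
  move=> x [Sx Qx] Sk; near=> t; split; last first.
    have -> : t *: const_mx 1 = const_mx t :> 'rV[R]_d.
      by apply/rowP => i; rewrite !mxE mulr1.
    by rewrite addrC quad_dev_shift.
  rewrite coord_sumD coord_sumZ coord_sum_const mulr1.
  have dR : 0 < d%:R :> R by rewrite ltr0n.
  have t0 : 0 < t by [].
  (* A diagonal step of size [t] raises S by [t * d%:R], which fits into the positive gap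
     [k - coord_sum x] for small [t]. *)
  have td : t * d%:R <= k - coord_sum x.
    rewrite -ler_pdivlMr//; near: t; apply: nbhs_right_le.
    by rewrite divr_gt0 ?subr_gt0 ?ltr0n.
  move: Sx; rewrite !ler_norml => /andP[kS _].
  have : 0 < t * d%:R by rewrite mulr_gt0.
  by move=> ?; apply/andP; split; lra.
Unshelve. all: by end_near. Qed.
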